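(* Let $\mathcal{F}$ be a hereditary family of finite subsets of $\mathbb{N}$. Then for every countable ordinal $\xi$, every infinite subset $M$ of $\mathbb{N}$ and every $\xi$-uniform family $\mathcal{L}$ on $M$ there exists an infinite subset $L$ of $M$ such that either $\mathcal{L}\cap[L]^{<\omega}\subseteq\mathcal{F}$, or $\mathcal{F}\cap[L]^{<\omega}\subseteq\mathcal{L}^{*}\setminus\mathcal{L}$.
   Context: $\mathbb{N}=\{1,2,3,\dots\}$. For an infinite $M\subseteq\mathbb{N}$, $[M]^{<\omega}$ is the set of all finite subsets of $M$ and $[M]$ the set of all infinite subsets of $M$. For finite sets, $s<t$ means $\max s<\min t$ (vacuously true if one of them is empty). A family is hereditary if it contains every subset of each of its elements. $\mathcal{L}^{*}$ denotes the family of all initial segments (not necessarily proper, including $\emptyset$) of elements of $\mathcal{L}$. Uniform families. Let $M\in[\mathbb{N}]$ and $\mathcal{L}\subseteq[M]^{<\omega}$. For $m\in M$ put $\mathcal{L}(m)=\{s\in[M]^{<\omega}:\{m\}\cup s\in\mathcal{L}\text{ and }\{m\}<s\}$. For countable ordinals $\xi$, ''$\mathcal{L}$ is $\xi$-uniform on $M$'' is defined recursively: (1) $\mathcal{L}$ is $0$-uniform on $M$ if $\mathcal{L}=\{\emptyset\}$; (2) if $\xi=\zeta+1$, $\mathcal{L}$ is $\xi$-uniform on $M$ if $\emptyset\notin\mathcal{L}$ and $\mathcal{L}(m)$ is $\zeta$-uniform on $M\cap(m,+\infty)$ for every $m\in M$; (3) if $\xi$ is a nonzero limit ordinal, $\mathcal{L}$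 is $\xi$-uniform on $M$ if $\emptyset\notin\mathcal{L}$ and there is an increasing sequence $(\xi_m)_{m\in M}$ of ordinals smaller than $\xi$ with $\sup_m\xi_m=\xi$ such that $\mathcal{L}(m)$ is $\xi_m$-uniform on $M\cap(m,+\infty)$ for every $m\in M$. *)

(* Defs.v *)
From HB Require Import structures.
From mathcomp Require Import all_boot all_order finmap.
From mathcomp Require Import boolp classical_sets cardinality.
Set Implicit Arguments.
Unset Strict Implicit.
Unset Printing Implicit Defensive.
Import Order.TTheory.
Local Open Scope fset_scope.
Local Open Scope classical_set_scope.

(** The natural numbers start at 1 here. *)
Definition NN : set nat := [set n | (0 < n)%N].

(** [M]^{<omega} *)
Definition finsubsets (M : set nat) : set {fset nat} :=
  [set s | forall n, n \in s -> M n].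

(** s < t, that is max s < min t, true when s or t is empty. *)
Definition precedes (s t : {fset nat}) : Prop :=
  forall m n, m \in s -> n \in t -> (m < n)%N.

Definition hereditary (F : set {fset nat}) : Prop :=
  forall s t : {fset nat}, F s -> (t `<=` s)%fset -> F t.

Definition initial_segment (t s : {fset nat}) : Prop :=
  (t `<=` s)%fset /\ precedes t (s `\` t)%fset.

(** L^* *)
Definition star (L : set {fset nat}) : set {fset nat} :=
  [set t | exists2 s, L s & initial_segment t s].

(** L(m), for a family L on M *)
Definition link (M : set nat) (L : set {fset nat}) (m : nat) :
    set {fset nat} :=
  [set s | [/\ finsubsets M s, L (m |` s)%fset & precedes [fset m]%fset s]].

(** Ordinals are represented as the elements of an arbitrary well-ordered type
    [W]: [x : W] stands for the order type of its set of predecessors.  Being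
    zero, a successor, a limit, or the supremum of smaller ordinals depends
    only on the elements up to [x], hence not on the choice of [W]. *)
Definition well_ordered (d : Order.disp_t) (W : orderType d) : Prop :=
  well_founded (fun x y : W => (x < y)%O).

Definition countable_ord (d : Order.disp_t) (W : orderType d) (x : W) : Prop :=
  countable [set y : W | (y < x)%O].

Definition zero_ord (d : Order.disp_t) (W : orderType d) (x : W) : Prop :=
  forall y : W, (x <= y)%O.

(** x = z + 1 *)
Definition succ_ord (d : Order.disp_t) (W : orderType d) (z x : W) : Prop :=
  (z < x)%O /\ forall y : W, (y < x)%O -> (y <= z)%O.

Definition limit_ord (d : Order.disp_t) (W : orderType d) (x : W) : Prop :=
  ~ zero_ord x /\ ~ exists z : W, succ_ord z x.

(** [uniform xi M L]: L is xi-uniform on M.  The standing assumptions, that M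
    is infinite and that every member of L is a subset of M, are not part of
    the predicate; they pass from M and L to [M `&` [set n | m < n]] and
    [link M L m]. *)
Inductive uniform (d : Order.disp_t) (W : orderType d) :
    W -> set nat -> set {fset nat} -> Prop :=
| uniform_zero (xi : W) (M : set nat) (L : set {fset nat}) :
    zero_ord xi ->
    L = [set fset0] ->
    uniform xi M L
| uniform_succ (xi zeta : W) (M : set nat) (L : set {fset nat}) :
    succ_ord zeta xi ->
    ~ L fset0 ->
    (forall m, M m ->
       uniform zeta (M `&` [set n | (m < n)%N]) (link M L m)) ->
    uniform xi M L
| uniform_limit (xi : W) (xi_ : nat -> W) (M : set nat) (L : set {fset nat}) :
    limit_ord xi ->
    ~ L fset0 ->
    (forall m n, M m -> M n -> (m < n)%N -> (xi_ m < xi_ n)%O) ->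
    (forall m, M m -> (xi_ m < xi)%O) ->
    supremums [set xi_ m | m in M] xi ->
    (forall m, M m ->
       uniform (xi_ m) (M `&` [set n | (m < n)%N]) (link M L m)) ->
    uniform xi M L.

(* Main.v *)
Require Import Defs.
From mathcomp Require Import all_boot all_order finmap.
From mathcomp Require Import boolp classical_sets cardinality.
Local Open Scope classical_set_scope.

(** A uniform family [L] on [M] is a front: every infinite subset of [M] has an
    initial segment in [L] ([front_dense]).  Fronts have the Ramsey property of
    Nash-Williams ([front_ramsey]): for any family [F] there is an infinite
    [N `<=` M] such that the members of [L] inside [N] are either all in [F] or
    all outside [F].  It is proved by induction on the front, by diagonalising
    over the links [link M L m] ([diagonalization]) and applying the pigeonhole
    principle to the two possible answers at [m].

    The first answer is the first alternative of the theorem.  In the second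
    case, take [s] in [F] with [s] inside [N], and continue [s] by all the
    elements of [N] beyond it.  The resulting infinite set has an initial
    segment [t] in [L], and [s], [t] are comparable, being initial segments of
    the same set.  If [t] were contained in [s], heredity would put [t] in [F],
    against the choice of [N]; so [s] is an initial segment of [t], that is,
    [s] is in [L^*], and [s] is not in [L] since it is in [F]. *)

(** The well-founded tree of links behind a uniform family, on which both the
    Ramsey property and density are proved by induction. *)
Inductive front : set nat -> set {fset nat} -> Prop :=
| front_leaf M : front M [set fset0]
| front_node (M : set nat) (L : set {fset nat}) :
    ~ L fset0 ->
    (forall m, M m -> front (M `&` [set n | (m < n)%N]) (link M L m)) ->
    front M L.

Lemma uniform_front (d : Order.disp_t) (W : orderType d) (xi : W)
  (M : set nat) (L : set {fset nat}) : uniform xi M L -> front M L.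
Proof.
elim=> {xi M L} [xi M L _ ->|xi zeta M L _ L0 _ IH|xi xi_ M L _ L0 _ _ _ _ IH].
- exact: front_leaf.
- exact: front_node.
- exact: front_node.
Qed.

Lemma finsubsetsS (A B : set nat) : A `<=` B -> finsubsets A `<=` finsubsets B.
Proof. by move=> AB s sA n /sA /AB. Qed.

Lemma infinite_tail (A : set nat) (m : nat) :
  infinite_set A -> infinite_set (A `&` [set n | (m < n)%N]).
Proof.
move=> Ainf tail_fin; apply: Ainf.
apply: (@sub_finite_set _ _ (`I_m.+1 `|` (A `&` [set n | (m < n)%N]))).
  by move=> n An; case: (leqP n m) => nm; [left|right].
by rewrite finite_setU; split => //; exact: finite_II.
Qed.

Lemma nat_set_min (A : set nat) : A !=set0 ->
  exists2 m, A m & forall n, A n -> (m <= n)%N.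
Proof.
case=> a Aa.
have exA : exists n, `[< A n >] by exists a; apply/asboolP.
case: (ex_minnP exA) => m /asboolP Am m_min.
by exists m => // n An; apply: m_min; apply/asboolP.
Qed.

Lemma pigeonhole (N P Q : set nat) : infinite_set N ->
  (forall m, N m -> P m \/ Q m) ->
  infinite_set (N `&` P) \/ infinite_set (N `&` Q).
Proof.
move=> Ninf PQ; apply: contrapT => /not_orP[/contrapT NP /contrapT NQ].
apply: Ninf; apply: (@sub_finite_set _ _ (N `&` P `|` N `&` Q)).
  by move=> m Nm; case: (PQ m Nm); [left|right].
by rewrite finite_setU.
Qed.

(** Choose [m_0] in [A_0 = M], then [A_1 `<=` A_0] beyond [m_0] with
    [D m_0 A_1], then [m_1] in [A_1], and so on.  All the elements chosen after
    [m_i] lie in [A_(i+1)], so [N = {m_0 < m_1 < ...}] works as soon as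
    [D m] is inherited by subsets. *)
Lemma diagonalization (D : nat -> set nat -> Prop) (M : set nat) :
  infinite_set M ->
  (forall m A B, A `<=` B -> D m B -> D m A) ->
  (forall m A, M m -> A `<=` M `&` [set n | (m < n)%N] -> infinite_set A ->
     exists B, [/\ B `<=` A, infinite_set B & D m B]) ->
  exists N, [/\ N `<=` M, infinite_set N &
    forall m, N m -> D m (N `&` [set n | (m < n)%N])].
Proof.
move=> Minf Dmono Dstep.
pose good (A : set nat) := A `<=` M /\ infinite_set A.
have /choice[g gP] : forall A, exists p : nat * set nat, good A ->
    [/\ A p.1, p.2 `<=` A `&` [set n | (p.1 < n)%N], good p.2 & D p.1 p.2].
  move=> A; case: (pselect (good A)) => [[AM Ainf]|nA]; last by exists (0, A).
  have [m Am] := infinite_setN0 Ainf.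
  have [|B [BA Binf DB]] :=
    Dstep m (A `&` [set n | (m < n)%N]) (AM _ Am) _ (infinite_tail _ m Ainf).
    by move=> n [/AM Mn mn].
  exists (m, B) => _; split=> //; split=> //= n /BA[An _]; exact: AM.
pose A i := iter i (fun X => (g X).2) M.
pose m i := (g (A i)).1.
have Agood i : good (A i).
  by elim: i => [|i IH]; [split|case: (gP _ IH)].
have Am i : A i (m i) by case: (gP _ (Agood i)).
have AS i : A i.+1 `<=` A i `&` [set n | (m i < n)%N].
  by case: (gP _ (Agood i)).
have Adec i j : (i <= j)%N -> A j `<=` A i.
  move=> /subnK <-; elim: (j - i)%N => [|k IH] //.
  by rewrite addSn => n /AS[] /IH.
have m_lt i j : (i < j)%N -> (m i < m j)%N.
  by move=> ij; case: (AS i _ (Adec _ _ ij _ (Am j))).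
have m_inj : injective m.
  by move=> i j ij; case: (ltngtP i j) => // /m_lt; rewrite ij ltnn.
exists (range m); split.
- by move=> _ [i _ <-]; apply: (Adec 0 i).
- have /eq_finite_set -> : (range m #= [set: nat])%card.
    by apply: inj_card_eq => ? ? _ _; exact: m_inj.
  exact: infinite_nat.
- move=> _ [i _ <-]; apply: (Dmono _ _ (A i.+1)); last by case: (gP _ (Agood i)).
  move=> _ [[j _ <-] /= mij]; have [ij|ji] := ltnP i j; first exact: (Adec _ _ ij).
  move: ji mij; rewrite leq_eqVlt => /orP[/eqP->|/m_lt/ltnW].
    by rewrite ltnn.
  by rewrite leqNgt => /negP.
Qed.

(** Removing the least element [m] of a member of [L] leads to the link at
    [m], which reduces a question on [L] to the same question on its links. *)
Lemma mem_link_min (M : set nat) (L : set {fset nat}) (s : {fset nat}) :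
  ~ L fset0 -> L s -> finsubsets M s ->
  exists (m : nat) (t : {fset nat}), s = (m |` t)%fset /\ link M L m t.
Proof.
move=> L0 Ls sM.
have /nat_set_min[m ms m_min] : [set n | n \in s] !=set0.
  by case: (fset_0Vmem s) => [s0|[n ns]]; [rewrite s0 in Ls|exists n].
have sE : s = (m |` (s `\ m))%fset by rewrite fsetD1K.
exists m, (s `\ m)%fset; split=> //.
split=> [n|//|a n]; first by rewrite in_fsetD1 => /andP[_ /sM].
- by rewrite -sE.
rewrite inE => /eqP -> /[!in_fsetD1] /andP[nm /m_min].
by rewrite leq_eqVlt eq_sym (negbTE nm).
Qed.

Definition homogeneous (L F : set {fset nat}) (N : set nat) : Prop :=
  L `&` finsubsets N `<=` F \/ L `&` finsubsets N `<=` ~` F.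

(** The quantification over the infinite subsets [M'] of [M] makes the
    induction go through: along the diagonalisation the links are considered
    on smaller and smaller sets. *)
Lemma front_ramsey (M : set nat) (L : set {fset nat}) : front M L ->
  forall (F : set {fset nat}) (M' : set nat), M' `<=` M -> infinite_set M' ->
  exists N, [/\ N `<=` M', infinite_set N & homogeneous L F N].
Proof.
elim=> {M L} [M F M' _ M'inf|M L L0 _ IH F M' M'M M'inf].
  exists M'; split=> //.
  by case: (pselect (F fset0)) => F0; [left|right]; move=> _ [-> _].
pose F_ (m : nat) := [set t | F (m |` t)%fset].
pose all_in (m : nat) (A : set nat) := link M L m `&` finsubsets A `<=` F_ m.
pose all_out (m : nat) (A : set nat) :=
  link M L m `&` finsubsets A `<=` ~` F_ m.
have link_mono m (A B : set nat) : A `<=` B ->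
    link M L m `&` finsubsets A `<=` link M L m `&` finsubsets B.
  by move=> AB; apply: setIS; exact: finsubsetsS.
have [| |N [NM' Ninf Nhom]] :=
  @diagonalization (fun m => homogeneous (link M L m) (F_ m)) M' M'inf.
- by move=> m A B /(link_mono m) AB [h|h]; [left|right]; apply: (subset_trans AB h).
- move=> m A M'm AM' Ainf; apply: IH => //; first exact: M'M.
  by move=> n /AM'[/M'M Mn mn].
(* A member of [L] inside [P `<=` N] is decided by the answer at its least
   element, so it suffices that this answer is constant on [P]. *)
have lift (P : set nat) (G : set {fset nat}) : P `<=` N ->
    (forall m, P m -> link M L m `&` finsubsets (N `&` [set n | (m < n)%N])
       `<=` [set t | G (m |` t)%fset]) ->
    L `&` finsubsets P `<=` G.
  move=> PN h s [Ls sP].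
  have sM : finsubsets M s by move=> n /sP /PN /NM' /M'M.
  have [m [t [sE tl]]] := mem_link_min _ _ _ L0 Ls sM.
  move: sP; rewrite sE => sP.
  apply: (h m (sP _ (fset1U1 _ _))); split=> // n nt; split.
    by apply/PN/sP; rewrite in_fset1U nt orbT.
  by case: tl => _ _; apply=> //; rewrite inE.
pose tail m := N `&` [set n | (m < n)%N].
have [Pinf|Pinf] := pigeonhole N [set m | all_in m (tail m)]
  [set m | all_out m (tail m)] Ninf Nhom.
- exists (N `&` [set m | all_in m (tail m)]); split=> //.
    by move=> n [/NM'].
  by left; apply: lift => [n []|m []].
- exists (N `&` [set m | all_out m (tail m)]); split=> //.
    by move=> n [/NM'].
  by right; apply: lift => [n []|m []].
Qed.

(** The analogue of [initial_segment] for an ambient set that may be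
    infinite. *)
Definition initial_in (X : set nat) (t : {fset nat}) : Prop :=
  finsubsets X t /\ forall n, X n -> n \in t \/ precedes t [fset n]%fset.

(** The least element [m] of [X] selects a link; there the tail of [X] beyond
    [m] has an initial segment, which is completed by [m]. *)
Lemma front_dense (M : set nat) (L : set {fset nat}) : front M L ->
  forall X, X `<=` M -> infinite_set X -> exists2 t, L t & initial_in X t.
Proof.
elim=> {M L} [M X _ _|M L L0 _ IH X XM Xinf].
  by exists fset0 => //; split=> // n Xn; right=> m.
have [m Xm m_min] := nat_set_min X (infinite_setN0 Xinf).
have [| |t [tM Lt mt] [tX t_init]] :=
  IH m (XM _ Xm) (X `&` [set n | (m < n)%N]).
- by move=> n [/XM].
- exact: infinite_tail.
exists (m |` t)%fset => //; split.
  by move=> n; rewrite in_fset1U => /orP[/eqP->//|/tX[]].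
move=> n Xn; move: (m_min n Xn); rewrite leq_eqVlt => /orP[/eqP<-|mn].
  by left; rewrite fset1U1.
have [nt|tn] := t_init n (conj Xn mn); first by left; rewrite in_fset1U nt orbT.
right=> a b; rewrite in_fset1U => /orP[/eqP->|/tn]; last exact.
by rewrite inE => /eqP->.
Qed.

Lemma initial_in_comparable (X : set nat) (s t : {fset nat}) :
  initial_in X s -> initial_in X t -> (t `<=` s)%fset \/ initial_segment s t.
Proof.
move=> [sX s_init] [tX t_init].
case: (boolP (t `<=` s)%fset) => [|/fsubsetPn[a at_ a_s]]; [by left|right].
have sa : precedes s [fset a]%fset.
  by case: (s_init a (tX _ at_)) => //; rewrite (negbTE a_s).
split.
  apply/fsubsetP => b bs; have [//|tb] := t_init b (sX _ bs).
  have ab := tb _ _ at_ (fset11 b).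
  by have := ltn_trans ab (sa _ _ bs (fset11 a)); rewrite ltnn.
move=> b c bs; rewrite in_fsetD => /andP[c_s ct].
have [|sc] := s_init c (tX _ ct); first by rewrite (negbTE c_s).
exact: sc bs (fset11 c).
Qed.

Lemma end_extension (N : set nat) (s : {fset nat}) :
  infinite_set N -> finsubsets N s ->
  exists X, [/\ X `<=` N, infinite_set X & initial_in X s].
Proof.
move=> Ninf sN.
exists (N `&` [set n | n \in s \/ precedes s [fset n]%fset]); split.
- by move=> n [].
- have sup := infinite_tail N (\max_(i <- s) i) Ninf.
  apply: sub_infinite_set sup => n [Nn /= sn]; split=> //; right=> a b a_s.
  rewrite inE => /eqP->; apply: leq_ltn_trans sn.
  exact: (@leq_bigmax_seq _ _ xpredT id).
- by split=> [n ns|n []//]; split; [exact: sN|left].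
Qed.

Theorem theoremB
  (F : set {fset nat})
  (F_fin : F `<=` finsubsets NN)
  (F_her : hereditary F)
  (d : Order.disp_t) (W : orderType d)
  (W_wo : well_ordered W)
  (xi : W)
  (xi_countable : countable_ord xi)
  (M : set nat)
  (M_sub : M `<=` NN)
  (M_inf : infinite_set M)
  (L : set {fset nat})
  (L_sub : L `<=` finsubsets M)
  (L_unif : uniform xi M L) :
  exists N : set nat,
    [/\ N `<=` M, infinite_set N &
      (L `&` finsubsets N `<=` F) \/
      (F `&` finsubsets N `<=` star L `\` L)].
Proof.
have L_front := uniform_front _ _ _ _ _ L_unif.
have [N [NM Ninf [LF|LnF]]] :=
  front_ramsey _ _ L_front F M (@subset_refl _ M) M_inf.
  by exists N; split=> //; left.
exists N; split=> //; right=> s [Fs sN].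
split; last by move=> Ls; exact: (LnF s).
have [X [XN Xinf sX]] := end_extension _ _ Ninf sN.
have [t Lt tX] := front_dense _ _ L_front X (subset_trans XN NM) Xinf.
have [ts|st] := initial_in_comparable _ _ _ sX tX; last by exists t.
have tN : finsubsets N t := finsubsetsS _ _ XN _ tX.1.
by case: (LnF t (conj Lt tN)); exact: F_her ts.
Qed.
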